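(* Let $x_{i+1}=g(x_i)$, $g:\mathbb{R}^n\to\mathbb{R}^n$, be a $\Gamma$-equivariant dynamical system with respect to the actions $\Gamma_\rho=\{\gamma_\rho:\gamma\in\Gamma\}$ on $\mathbb{R}^n$, let $\mathcal{K}$ be its Koopman operator, and let $\lambda\in\mathbb{C}$. Then the space of eigenfunctions of $\mathcal{K}$ with eigenvalue $\lambda$ is $\Gamma$-invariant: if $\phi:\mathbb{R}^n\to\mathbb{C}$ is an eigenfunction of $\mathcal{K}$ with eigenvalue $\lambda$, then for every $\gamma\in\Gamma$ the function $\gamma_\rho\circ\phi$ is also an eigenfunction of $\mathcal{K}$ with eigenvalue $\lambda$.
   Context: $\Gamma$ is a finite group acting on the state space $\mathbb{R}^n$; the action of $\gamma\in\Gamma$ is denoted $\gamma_\rho:\mathbb{R}^n\to\mathbb{R}^n$ (not necessarily linear), and the set $\Gamma_\rho$ of these actions is a group isomorphic to $\Gamma$. The system $x_{i+1}=g(x_i)$ is $\Gamma$-equivariant with respect to $\Gamma_\rho$ if $g(\gamma_\rho x)=\gamma_\rho g(x)$ for all $x\in\mathbb{R}^n$ and $\gamma_\rho\in\Gamma_\rho$. The Koopman operator $\mathcal{K}$ acts on functions $f:\mathbb{R}^n\to\mathbb{C}$ by $(\mathcal{K}f)(x)=f(g(x))$. The group acts on functions by $(\gamma_\rho\circ f)(x)=f(\gamma_\rho^{-1}x)$. An eigenfunction of $\mathcal{K}$ with eigenvalue $\lambda$ is a nonzero function $\phi$ with $(\mathcal{K}\phi)(x)=\lambda\phi(x)$ for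 all $x$. *)

(* Defs.v *)
From HB Require Import structures.
From mathcomp Require Import all_boot all_order all_algebra all_fingroup.
From mathcomp Require Import complex.
From mathcomp Require Import boolp classical_sets functions reals.

Set Implicit Arguments.
Unset Strict Implicit.
Unset Printing Implicit Defensive.

Import Order.TTheory GRing.Theory Num.Theory.

Local Open Scope ring_scope.

(* MathComp's {action gT &-> X} is a right action, whereas the maps rho gamma
   compose as (rho gamma) \o (rho delta) = rho (gamma * delta).  Injectivity of
   gamma |-> rho gamma makes the group of maps { rho gamma } isomorphic to gT,
   and not merely a quotient of it. *)
Record faithful_left_action (gT : finGroupType) (X : Type)
    (rho : gT -> X -> X) : Prop := FaithfulLeftAction {
  left_action1 : rho 1%g = id;
  left_actionM : forall gamma delta : gT,
    rho (gamma * delta)%g = rho gamma \o rho delta;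
  left_action_inj : injective rho }.

Definition equivariant (gT : finGroupType) (X : Type)
    (rho : gT -> X -> X) (g : X -> X) : Prop :=
  forall (gamma : gT) (x : X), g (rho gamma x) = rho gamma (g x).

Definition koopman (X Y : Type) (g : X -> X) (f : X -> Y) : X -> Y :=
  fun x => f (g x).

(* 'pinv_id setT s is the two-sided inverse of the map s : X -> X whenever s is
   bijective, as every map of a left action is. *)
Definition act_on_fun (X Y : Type) (s : X -> X) (f : X -> Y) : X -> Y :=
  fun x => f ('pinv_id setT s x).

Definition eigenfunction (X : Type) (C : pzRingType)
    (K : (X -> C) -> (X -> C)) (lambda : C) (phi : X -> C) : Prop :=
  phi <> (fun=> 0) /\ forall x, K phi x = lambda * phi x.

(* Main.v *)
Require Import Defs.
From HB Require Import structures.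
From mathcomp Require Import all_boot all_order all_algebra all_fingroup.
From mathcomp Require Import complex.
From mathcomp Require Import boolp classical_sets functions reals.

(** Equivariance makes the Koopman operator commute with the action on functions:
    $\phi(\gamma_\rho^{-1} g(x)) = \phi(g(\gamma_\rho^{-1} x)) = \lambda\phi(\gamma_\rho^{-1} x)$.
    Bijectivity of $\gamma_\rho$ keeps the transformed function nonzero. *)

Lemma left_actionK (gT : finGroupType) (X : Type) (rho : gT -> X -> X)
    (gamma : gT) :
  faithful_left_action rho -> cancel (rho gamma) (rho gamma^-1%g).
Proof.
move=> [rho1 rhoM _] x.
by have /(congr1 (@^~ x)) /= := rhoM gamma^-1%g gamma; rewrite mulVg rho1.
Qed.

Lemma left_actionVK (gT : finGroupType) (X : Type) (rho : gT -> X -> X)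
    (gamma : gT) :
  faithful_left_action rho -> cancel (rho gamma^-1%g) (rho gamma).
Proof.
by move=> rhoA x; rewrite -{1}[gamma]invgK (left_actionK _ _ _ gamma^-1%g rhoA).
Qed.

(** Trades the pseudo-inverse for the action of a group element, to which equivariance applies.
    Since [rho gamma] is injective, its pseudo-inverse cancels it at
    [x = rho gamma (rho gamma^-1 x)]. *)
Lemma act_on_funE (gT : finGroupType) (X Y : Type) (rho : gT -> X -> X)
    (gamma : gT) (f : X -> Y) (x : X) :
  faithful_left_action rho ->
  act_on_fun (rho gamma) f x = f (rho gamma^-1%g x).
Proof.
move=> rhoA; rewrite /act_on_fun -{1}[x](left_actionVK _ _ _ gamma rhoA).
rewrite pinvKV ?inE//.
by move=> y z _ _; apply: (can_inj (left_actionK _ _ _ gamma rhoA)).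
Qed.

Theorem mainTheorem2 (R : realType) (n : nat) (gT : finGroupType)
    (rho : gT -> 'cV[R]_n -> 'cV[R]_n) (g : 'cV[R]_n -> 'cV[R]_n)
    (lambda : R[i]) :
  faithful_left_action rho ->
  equivariant rho g ->
  forall phi : 'cV[R]_n -> R[i],
    eigenfunction (koopman g) lambda phi ->
    forall gamma : gT,
      eigenfunction (koopman g) lambda (act_on_fun (rho gamma) phi).
Proof.
move=> rhoA equiv phi [phi_neq0 phi_eigen] gamma; split.
  apply: contra_not phi_neq0 => phi0; apply: funext => x.
  (* The value of [phi] at [x] is that of the transformed function at [rho gamma x]. *)
  by rewrite -[x](left_actionK _ _ _ gamma rhoA) -act_on_funE// phi0.
(* Equivariance is used at [gamma^-1], leaving the eigenvalue equation of [phi] at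
   [rho gamma^-1 x]. *)
move=> x; rewrite /koopman !act_on_funE// -equiv.
exact: phi_eigen.
Qed.
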